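(* For all integers $n,k\ge 0$ there are isomorphisms of $\mathbb{C}$-algebras: 1. $\mathcal{C}(2n,2k)\simeq \mathcal{M}_{2^n}(\mathsf{W}_{2k})$. 2. $\mathcal{C}(2n+1,2k)\simeq \mathcal{M}_{2^n}(\mathcal{C}(1,2k))$.
   Context: All algebras are unital associative over $\mathbb{C}$. For $n,k\ge 0$ the Clifford--Weyl algebra $\mathcal{C}(n,2k)$ is the algebra with generators $\omega_1,\dots,\omega_n,p_1,q_1,\dots,p_k,q_k$ and relations $\omega_i\omega_j+\omega_j\omega_i=2\delta_{ij}$; $p_iq_j-q_jp_i=\delta_{ij}$, $p_ip_j=p_jp_i$, $q_iq_j=q_jq_i$; $\omega_ip_j+p_j\omega_i=0$, $\omega_iq_j+q_j\omega_i=0$ for all $i,j$. The Weyl algebra is $\mathsf{W}_{2k}=\mathcal{C}(0,2k)$. For an algebra $A$ and $r\ge 1$, $\mathcal{M}_r(A)$ is the algebra of $r\times r$ matrices with entries in $A$. *)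

(* Defs.v *)
From HB Require Import structures.
From mathcomp Require Import all_boot all_order all_algebra.
From mathcomp Require Import generic_quotient ring_quotient.
From mathcomp Require Import boolp functions.
From mathcomp Require Import finmap monalg.

Set Implicit Arguments.
Unset Strict Implicit.
Unset Printing Implicit Defensive.

Import GRing.Theory.
Local Open Scope ring_scope.
Local Open Scope quotient_scope.

(* 'M[A]_r as a K-algebra, for a K-algebra A; the library only provides the
   scalar action of A itself.  For r = 0 it is the zero ring, hence a
   pzRingType. *)
Definition mx_alg (r : nat) (A : Type) : Type := 'M[A]_r.

Section MatrixAlgebra.
Variables (K : pzRingType) (A : algType K) (r : nat).
Implicit Types (c : K) (M N : mx_alg r A).

HB.instance Definition _ := GRing.PzRing.copy (mx_alg r A) 'M[A]_r.

Definition mx_alg_scale c M : mx_alg r A := \matrix_(i, j) (c *: M i j).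

Fact mx_alg_scaleA c d M :
  mx_alg_scale c (mx_alg_scale d M) = mx_alg_scale (c * d) M.
Proof. by apply/matrixP=> i j; rewrite !mxE scalerA. Qed.

Fact mx_alg_scale1 : left_id 1 mx_alg_scale.
Proof. by move=> M; apply/matrixP=> i j; rewrite !mxE scale1r. Qed.

Fact mx_alg_scaleDr : right_distributive mx_alg_scale +%R.
Proof. by move=> c M N; apply/matrixP=> i j; rewrite !mxE scalerDr. Qed.

Fact mx_alg_scaleDl M : {morph mx_alg_scale^~ M : c d / c + d}.
Proof. by move=> c d; apply/matrixP=> i j; rewrite !mxE scalerDl. Qed.

HB.instance Definition _ := GRing.Zmodule_isLmodule.Build K (mx_alg r A)
  mx_alg_scaleA mx_alg_scale1 mx_alg_scaleDr mx_alg_scaleDl.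

Fact mx_alg_scaleAl c M N : c *: (M * N) = (c *: M) * N.
Proof.
apply/matrixP=> i j; rewrite !mxE scaler_sumr.
by apply: eq_bigr => k _; rewrite mxE scalerAl.
Qed.

Fact mx_alg_scaleAr c M N : c *: (M * N) = M * (c *: N).
Proof.
apply/matrixP=> i j; rewrite !mxE scaler_sumr.
by apply: eq_bigr => k _; rewrite mxE scalerAr.
Qed.

End MatrixAlgebra.

Section QuotientAlgebra.
Variables (K : comNzRingType) (A : algType K).

Inductive ideal_gen (E : A -> Prop) : A -> Prop :=
| IdealGen x of E x : ideal_gen E x
| Ideal0 : ideal_gen E 0
| IdealB x y of ideal_gen E x & ideal_gen E y : ideal_gen E (x - y)
| IdealMl a x of ideal_gen E x : ideal_gen E (a * x)
| IdealMr a x of ideal_gen E x : ideal_gen E (x * a).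

Definition idealb (E : A -> Prop) : A -> bool := fun x => `[< ideal_gen E x >].

Variable E : A -> Prop.

Fact idealb_zmod : zmod_closed (idealb E).
Proof.
split=> [|x y /asboolP Ix /asboolP Iy]; apply/asboolP; first exact: Ideal0.
exact: IdealB.
Qed.

HB.instance Definition _ := GRing.isZmodClosed.Build A (idealb E) idealb_zmod.

Definition quo_alg := Quotient.quot (GRing.ZmodClosed.clone A (idealb E) _).

HB.instance Definition _ := GRing.Zmodule.on quo_alg.
HB.instance Definition _ := ZmodQuotient.on quo_alg.

Local Notation pi := (\pi_quo_alg).

Fact quoP x y : ideal_gen E (x - y) <-> pi x = pi y.
Proof.
split=> [/asboolP Ixy|/eqP]; first by apply/eqP; rewrite -Quotient.idealrBE.
by rewrite -Quotient.idealrBE => /asboolP.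
Qed.

Fact quo_repr x : ideal_gen E (repr (pi x) - x).
Proof. by apply/quoP; rewrite reprK. Qed.

Definition quo_mul (u v : quo_alg) : quo_alg := pi (repr u * repr v).
Definition quo_scale (c : K) (u : quo_alg) : quo_alg := pi (c *: repr u).

Fact quo_mulE x y : quo_mul (pi x) (pi y) = pi (x * y).
Proof.
apply/quoP; set x' := repr _; set y' := repr _.
have ->: x' * y' - x * y = x' * (y' - y) - (x - x') * y.
  by rewrite mulrBr mulrBl opprB addrA subrK.
apply: IdealB; [apply: IdealMl | apply: IdealMr]; first exact: quo_repr.
by rewrite -opprB -sub0r; apply: IdealB; [apply: Ideal0 | apply: quo_repr].
Qed.

Fact quo_scaleE c x : quo_scale c (pi x) = pi (c *: x).
Proof.
apply/quoP; rewrite -scalerBr -[_ - x]mul1r scalerAl.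
by apply: IdealMl; apply: quo_repr.
Qed.

Fact quo_ind (P : quo_alg -> Prop) : (forall x, P (pi x)) -> forall u, P u.
Proof. by move=> Ppi u; rewrite -[u]reprK. Qed.

Let piD (x y : A) : pi x + pi y = pi (x + y).
Proof. by rewrite !piE. Qed.

Fact quo_mulA : associative quo_mul.
Proof. by do 3!elim/quo_ind=> ?; rewrite !quo_mulE mulrA. Qed.
Fact quo_mul1 : left_id (pi 1) quo_mul.
Proof. by elim/quo_ind=> ?; rewrite quo_mulE mul1r. Qed.
Fact quo_mulr1 : right_id (pi 1) quo_mul.
Proof. by elim/quo_ind=> ?; rewrite quo_mulE mulr1. Qed.
Fact quo_mulDl : left_distributive quo_mul +%R.
Proof. by do 3!elim/quo_ind=> ?; rewrite !(piD, quo_mulE) mulrDl. Qed.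
Fact quo_mulDr : right_distributive quo_mul +%R.
Proof. by do 3!elim/quo_ind=> ?; rewrite !(piD, quo_mulE) mulrDr. Qed.

HB.instance Definition _ := GRing.Zmodule_isPzRing.Build quo_alg
  quo_mulA quo_mul1 quo_mulr1 quo_mulDl quo_mulDr.

Fact quo_scaleA c d u : quo_scale c (quo_scale d u) = quo_scale (c * d) u.
Proof. by elim/quo_ind: u => ?; rewrite !quo_scaleE scalerA. Qed.
Fact quo_scale1 : left_id 1 quo_scale.
Proof. by elim/quo_ind=> ?; rewrite quo_scaleE scale1r. Qed.
Fact quo_scaleDr : right_distributive quo_scale +%R.
Proof. by move=> c; do 2!elim/quo_ind=> ?; rewrite !(piD, quo_scaleE) scalerDr. Qed.
Fact quo_scaleDl u : {morph quo_scale^~ u : c d / c + d}.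
Proof. by move=> c d; elim/quo_ind: u => ?; rewrite !quo_scaleE piD scalerDl. Qed.

HB.instance Definition _ := GRing.Zmodule_isLmodule.Build K quo_alg
  quo_scaleA quo_scale1 quo_scaleDr quo_scaleDl.

Fact quo_piM x y : pi (x * y) = pi x * pi y.
Proof. by rewrite -quo_mulE. Qed.

Fact quo_piZ c x : pi (c *: x) = c *: pi x.
Proof. by rewrite -quo_scaleE. Qed.

Fact quo_scaleAl c (u v : quo_alg) : c *: (u * v) = (c *: u) * v.
Proof.
by elim/quo_ind: u => x; elim/quo_ind: v => y; rewrite -!(quo_piM, quo_piZ) scalerAl.
Qed.

Fact quo_scaleAr c (u v : quo_alg) : c *: (u * v) = u * (c *: v).
Proof.
by elim/quo_ind: u => x; elim/quo_ind: v => y; rewrite -!(quo_piM, quo_piZ) scalerAr.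
Qed.

End QuotientAlgebra.

(* Noncommutative polynomials: the algebra of the free monoid on X.  The
   product and the generators are those of {malg K[{fmonom X}]}; they are
   locked only to keep unification from unfolding them. *)
Definition free_alg (K : comNzRingType) (X : choiceType) : Type :=
  {malg K[{fmonom X}]}.

HB.lock Definition free_mul (K : comNzRingType) (X : choiceType)
  (f g : free_alg K X) : free_alg K X := (f : {malg K[{fmonom X}]}) * g.

HB.lock Definition free_gen (K : comNzRingType) (X : choiceType) (x : X)
  : free_alg K X := << fmu x >>.

Section FreeAlgebra.
Variables (K : comNzRingType) (X : choiceType).
Local Notation free_alg := (free_alg K X).
Implicit Types (f g h : free_alg).

HB.instance Definition _ := GRing.Lmodule.copy free_alg {malg K[{fmonom X}]}.

Let one : free_alg := (1 : {malg K[{fmonom X}]}).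

Fact free_mulA : associative (@free_mul K X).
Proof. by move=> f g h; rewrite unlock mulrA. Qed.
Fact free_mul1 : left_id one (@free_mul K X).
Proof. by move=> f; rewrite unlock mul1r. Qed.
Fact free_mulr1 : right_id one (@free_mul K X).
Proof. by move=> f; rewrite unlock mulr1. Qed.
Fact free_mulDl : left_distributive (@free_mul K X) +%R.
Proof. by move=> f g h; rewrite unlock mulrDl. Qed.
Fact free_mulDr : right_distributive (@free_mul K X) +%R.
Proof. by move=> f g h; rewrite unlock mulrDr. Qed.
Fact free_one_neq0 : one != 0.
Proof. exact: oner_neq0. Qed.

HB.instance Definition _ := GRing.Zmodule_isNzRing.Build free_alg
  free_mulA free_mul1 free_mulr1 free_mulDl free_mulDr free_one_neq0.

Fact free_mulE f g : f * g = (f : {malg K[{fmonom X}]}) * g.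
Proof. by rewrite -[LHS]/(free_mul f g) unlock. Qed.

Fact free_scaleAl (c : K) f g : c *: free_mul f g = free_mul (c *: f) g.
Proof. by rewrite unlock scalerAl. Qed.

HB.instance Definition _ := GRing.Lmodule_isLalgebra.Build K free_alg
  free_scaleAl.

Fact free_scaleAr (c : K) f g : c *: free_mul f g = free_mul f (c *: g).
Proof.
rewrite unlock; apply/malgP=> m; rewrite mcoeffZ.
rewrite [RHS](@mcoeffMlw _ _ (msupp f) (msupp g) f (c *: g)) ?msuppZ_le //.
rewrite (mcoeffMl f g) mulr_sumr.
apply: eq_bigr => k1 _; rewrite mulr_sumr; apply: eq_bigr => k2 _.
by rewrite mcoeffZ mulrnAr !mulrA [c * _]mulrC.
Qed.

HB.instance Definition _ := GRing.Lalgebra_isAlgebra.Build K free_alg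
  free_scaleAr.

End FreeAlgebra.

Section FreeAlgebraAction.
Variables (K : comNzRingType) (X : choiceType).
Local Notation free_alg := (free_alg K X).

(* The action of free_alg on a module in which each generator x acts by T x. *)
Section Action.
Variables (V : lmodType K) (T : X -> {linear V -> V}).

Definition word_act (w : seq X) (v : V) : V := foldr (fun x => T x) v w.

Definition free_act (f : free_alg) (v : V) : V :=
  \sum_(w <- msupp f) f@_w *: word_act w v.

Fact word_act_linear w : linear (word_act w).
Proof. by move=> c u v; elim: w => //= x w ->; rewrite linearP. Qed.
HB.instance Definition _ w :=
  GRing.isLinear.Build K V V _ (word_act w) (word_act_linear w).

Fact free_actEw (d : {fset {fmonom X}}) f v : (msupp f `<=` d)%fset ->
  free_act f v = \sum_(w <- d) f@_w *: word_act w v.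
Proof.
move=> le; rewrite [LHS](big_fset_incl _ le) => //= x xd /mcoeff_outdom ->.
by rewrite scale0r.
Qed.

Fact free_actU c w v : free_act << c *g w >> v = c *: word_act w v.
Proof. by rewrite (free_actEw _ msuppU_le) big_seq_fset1 mcoeffUU. Qed.

Definition free_act_at v f := free_act f v.

Fact free_act_at_linear v : linear (free_act_at v).
Proof.
move=> c f g; rewrite /free_act_at; pose d := (msupp f `|` msupp g)%fset.
have lf : (msupp f `<=` d)%fset by apply: fsubsetUl.
have lg : (msupp g `<=` d)%fset by apply: fsubsetUr.
have lfg : (msupp (c *: f + g) `<=` d)%fset.
  apply: fsubset_trans (msuppD_le _ _) _; rewrite fsubUset lg andbT.
  exact: fsubset_trans (msuppZ_le _ _) lf.
rewrite (free_actEw _ lf) (free_actEw _ lg) (free_actEw _ lfg).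
rewrite scaler_sumr -big_split; apply: eq_bigr => w _ /=.
by rewrite mcoeffD mcoeffZ scalerDl scalerA.
Qed.
HB.instance Definition _ v :=
  GRing.isLinear.Build K free_alg V _ (free_act_at v) (free_act_at_linear v).

Fact free_act_linear f : linear (free_act f).
Proof.
move=> c u v; rewrite /free_act scaler_sumr -big_split; apply: eq_bigr => w _.
by rewrite linearP scalerDr !scalerA mulrC.
Qed.
HB.instance Definition _ f :=
  GRing.isLinear.Build K V V _ (free_act f) (free_act_linear f).

Fact free_act1 v : free_act 1 v = v.
Proof. by rewrite free_actU scale1r /word_act fm1. Qed.

Fact free_act_gen x v : free_act (free_gen K x) v = T x v.
Proof. by rewrite unlock free_actU scale1r /word_act fmU. Qed.

Fact free_act_nat r v : free_act r%:R v = v *+ r.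
Proof. by rewrite -/(free_act_at v _) linearMn /= /free_act_at free_act1. Qed.

Fact free_actD f g v : free_act (f + g) v = free_act f v + free_act g v.
Proof. exact: (linearD (free_act_at v)). Qed.

Fact free_actN f v : free_act (- f) v = - free_act f v.
Proof. exact: (linearN (free_act_at v)). Qed.

Fact free_actM f g v : free_act (f * g) v = free_act f (free_act g v).
Proof.
rewrite free_mulE malgME -/(free_act_at v _) linear_sum /=; apply: eq_bigr => w1 _.
rewrite linear_sum /= [in RHS]/free_act linear_sum scaler_sumr.
apply: eq_bigr => w2 _ /=.
by rewrite /free_act_at free_actU linearZ /= scalerA /word_act fmM foldr_cat.
Qed.

End Action.

End FreeAlgebraAction.

Section CliffordWeyl.
Variables (K : comNzRingType) (n k : nat).

Inductive CW_gen : Type := CWomega of 'I_n | CWp of 'I_k | CWq of 'I_k.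

Definition CW_gen_sum (g : CW_gen) : 'I_n + ('I_k + 'I_k) :=
  match g with CWomega i => inl i | CWp i => inr (inl i) | CWq i => inr (inr i) end.
Definition CW_gen_of_sum (s : 'I_n + ('I_k + 'I_k)) : CW_gen :=
  match s with inl i => CWomega i | inr (inl i) => CWp i | inr (inr i) => CWq i end.
Fact CW_gen_sumK : cancel CW_gen_sum CW_gen_of_sum. Proof. by case. Qed.
HB.instance Definition _ := Finite.copy CW_gen (can_type CW_gen_sumK).

Local Notation omega i := (free_gen K (CWomega i)).
Local Notation p i := (free_gen K (CWp i)).
Local Notation q i := (free_gen K (CWq i)).

Inductive CW_rel : free_alg K CW_gen -> Prop :=
| CW_omega_omega (i j : 'I_n) :
    CW_rel (omega i * omega j + omega j * omega i - 2%:R * (i == j)%:R)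
| CW_p_q (i j : 'I_k) : CW_rel (p i * q j - q j * p i - (i == j)%:R)
| CW_p_p (i j : 'I_k) : CW_rel (p i * p j - p j * p i)
| CW_q_q (i j : 'I_k) : CW_rel (q i * q j - q j * q i)
| CW_omega_p (i : 'I_n) (j : 'I_k) : CW_rel (omega i * p j + p j * omega i)
| CW_omega_q (i : 'I_n) (j : 'I_k) : CW_rel (omega i * q j + q j * omega i).

Section Module.
Variables (V : lmodType K) (T : CW_gen -> {linear V -> V}).
Hypothesis T_omega_omega : forall i j v,
  T (CWomega i) (T (CWomega j) v) + T (CWomega j) (T (CWomega i) v) = v *+ (i == j) *+ 2.
Hypothesis T_p_q : forall i j v,
  T (CWp i) (T (CWq j) v) - T (CWq j) (T (CWp i) v) = v *+ (i == j).
Hypothesis T_p_p : forall i j v, T (CWp i) (T (CWp j) v) = T (CWp j) (T (CWp i) v).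
Hypothesis T_q_q : forall i j v, T (CWq i) (T (CWq j) v) = T (CWq j) (T (CWq i) v).
Hypothesis T_omega_p : forall i j v,
  T (CWomega i) (T (CWp j) v) + T (CWp j) (T (CWomega i) v) = 0.
Hypothesis T_omega_q : forall i j v,
  T (CWomega i) (T (CWq j) v) + T (CWq j) (T (CWomega i) v) = 0.

Fact CW_rel_act f v : CW_rel f -> free_act T f v = 0.
Proof.
have gM a b u : free_act T (free_gen K a * free_gen K b) u = T a (T b u).
  by rewrite free_actM !free_act_gen.
have gD a b c d u : free_act T (free_gen K a * free_gen K b + free_gen K c * free_gen K d) u
    = T a (T b u) + T c (T d u).
  by rewrite free_actD (gM a b) (gM c d).
have gB a b c d u : free_act T (free_gen K a * free_gen K b - free_gen K c * free_gen K d) u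
    = T a (T b u) - T c (T d u).
  by rewrite free_actD free_actN (gM a b) (gM c d).
have actB f1 f2 u : free_act T (f1 - f2) u = free_act T f1 u - free_act T f2 u.
  by rewrite free_actD free_actN.
case=> i j; first by rewrite actB gD T_omega_omega free_actM !free_act_nat subrr.
- by rewrite actB gB T_p_q free_act_nat subrr.
- by rewrite gB T_p_p subrr.
- by rewrite gB T_q_q subrr.
- by rewrite gD T_omega_p.
- by rewrite gD T_omega_q.
Qed.

Fact ideal_gen_act f v : ideal_gen CW_rel f -> free_act T f v = 0.
Proof.
move=> If; elim: If v => {f} [f Ef|v|f g _ IHf _ IHg v|g f _ IH v|g f _ IH v].
- by move=> v; apply: CW_rel_act.
- exact: (linear0 (free_act_at T v)).
- by rewrite -/(free_act_at T v _) linearB /= /free_act_at IHf IHg subr0.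
- by rewrite free_actM IH linear0.
- by rewrite free_actM IH.
Qed.

End Module.

(* 1 != 0 in C(n, 2k), by the action on functions of (s, m), with s in
   {0,1}^n and m in nat^k, where p_i shifts m_i up, q_i shifts m_i down and
   multiplies by m_i, and omega_i flips s_i up to the sign (-1)^(the sum of
   the s_l, l < i, and of the m_j). *)
Section Representation.

Let idx : Type := {ffun 'I_n -> bool} * {ffun 'I_k -> nat}.
Implicit Types (s : {ffun 'I_n -> bool}) (m : {ffun 'I_k -> nat}).

Let flip i s : {ffun 'I_n -> bool} := [ffun l => s l (+) (l == i)].
Let up i m : {ffun 'I_k -> nat} := [ffun j => m j + (j == i)]%N.
Let down i m : {ffun 'I_k -> nat} := [ffun j => m j - (j == i)]%N.
Let par (i : 'I_n) s m : bool :=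
  (\big[addb/false]_(l < n | (l < i)%N) s l) (+) odd (\sum_j m j).

Let move_idx (g : CW_gen) (x : idx) : idx :=
  match g with
  | CWomega i => (flip i x.1, x.2)
  | CWp i => (x.1, up i x.2)
  | CWq i => (x.1, down i x.2)
  end.

Let coef (g : CW_gen) (x : idx) : K :=
  match g with
  | CWomega i => (-1) ^+ par i x.1 x.2
  | CWp i => 1
  | CWq i => (x.2 i)%:R
  end.

Definition CW_op (g : CW_gen) (v : idx -> K^o) : idx -> K^o :=
  fun x => coef g x *: v (move_idx g x).

Fact CW_op_linear g : linear (CW_op g).
Proof.
move=> c u v; apply/funext => x.
by rewrite /CW_op !fctE /= scalerDr !scalerA [c * _]mulrC.
Qed.
HB.instance Definition _ g :=
  GRing.isLinear.Build K (idx -> K^o) (idx -> K^o) _ (CW_op g) (CW_op_linear g).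

Let par_flip i j s m : par i (flip j s) m = par i s m (+) (j < i)%N.
Proof.
rewrite /par addbAC; congr (_ (+) _).
under eq_bigr do rewrite ffunE.
rewrite big_split /=; congr (_ (+) _).
case: ltnP => [ji|ij].
  by rewrite (bigD1 j) //= eqxx big1 // => l /andP[_ /negbTE].
by rewrite big1 // => l li; apply/eqP => lj; rewrite lj ltnNge ij in li.
Qed.

Let sum_up i m : (\sum_j up i m j = (\sum_j m j).+1)%N.
Proof.
under eq_bigr do rewrite ffunE.
rewrite big_split -[RHS]addn1 /=; congr (_ + _)%N.
by rewrite (bigD1 i) //= eqxx big1 // => j /negbTE->.
Qed.

Let par_up i j s m : par i s (up j m) = ~~ par i s m.
Proof. by rewrite /par sum_up /= addbN. Qed.

Let downK i m : (0 < m i)%N -> up i (down i m) = m.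
Proof.
move=> mi; apply/ffunP => j; rewrite !ffunE.
by case: eqP => [->|_]; rewrite ?subnK // subn0 addn0.
Qed.

Let upK i m : down i (up i m) = m.
Proof. by apply/ffunP => j; rewrite !ffunE addnK. Qed.

Let flipC i j s : flip j (flip i s) = flip i (flip j s).
Proof. by apply/ffunP => l; rewrite !ffunE addbAC. Qed.

Let flipK i s : flip i (flip i s) = s.
Proof. by apply/ffunP => l; rewrite !ffunE -addbA addbb addbF. Qed.

Let upC i j m : up j (up i m) = up i (up j m).
Proof. by apply/ffunP => l; rewrite !ffunE addnAC. Qed.

Let downC i j m : down j (down i m) = down i (down j m).
Proof. by apply/ffunP => l; rewrite !ffunE subnAC. Qed.

Let omegaE i v x : CW_op (CWomega i) v x
  = (-1) ^+ par i x.1 x.2 * v (flip i x.1, x.2).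
Proof. by []. Qed.
Let pE i v x : CW_op (CWp i) v x = v (x.1, up i x.2).
Proof. by rewrite /CW_op scale1r. Qed.
Let qE i v x : CW_op (CWq i) v x = (x.2 i)%:R * v (x.1, down i x.2).
Proof. by []. Qed.

Let opE := (omegaE, pE, qE).

Fact CW_one_neq0 : (1 : quo_alg CW_rel) != 0.
Proof.
apply/eqP; rewrite -[0](raddf0 \pi_(quo_alg CW_rel)) => /quoP; rewrite subr0.
move/(ideal_gen_act (T := CW_op)) => /(_ _ _ _ _ _ _ (fun=> 1)) I1.
suff: (fun=> 1 : K) = (fun=> 0) :> (idx -> K^o).
  by move/(congr1 (fun v => v ([ffun=> false], [ffun=> 0%N]))) => /eqP; rewrite oner_eq0.
rewrite -[LHS](free_act1 CW_op) I1 => {I1} // i j v; apply/funext => -[s m];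
  rewrite /= ?opE /=.
- rewrite !fctE !opE /= !par_flip !mulrA -!exprD flipC.
  have [->|ij] := eqVneq i j.
    rewrite ltnn addbF flipK mulr1n mulr2n fctE.
    by rewrite addnn -mul2n exprM sqrrN !expr1n !mul1r.
  rewrite mul0rn -mulrDl [X in X * _](_ : _ = 0) ?mul0r //.
  move: ij; rewrite -val_eqE /=.
  rewrite !exprD !signr_addb; case: ltngtP => // _ _;
    by rewrite expr0 expr1 mulr1 mulrN1 mulrN mulrC ?addNr ?addrN.
- rewrite !fctE !opE /=; have [->|ij] := eqVneq i j.
    rewrite upK ffunE eqxx addn1 mulr1n.
    have [m0|m0] := posnP (m j); first by rewrite m0 mul1r mul0r subr0.
    by rewrite downK // -mulrBl -natrB // subSnn mul1r.
  have -> : down j (up i m) = up i (down j m).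
    apply/ffunP => l; rewrite !ffunE.
    have [->|_] := eqVneq l i; last by rewrite !addn0.
    by rewrite (negbTE ij) !subn0.
  by rewrite ffunE eq_sym (negbTE ij) addn0 subrr.
- by rewrite upC.
- rewrite downC !ffunE; have [->|ij] := eqVneq i j; first by [].
  by rewrite !subn0 !mulrA [_%:R * _%:R]mulrC.
- by rewrite !fctE !opE /= par_up -mulrDl signrN addrN mul0r.
- rewrite !fctE !opE /=.
  have [m0|m0] := posnP (m j); first by rewrite m0 !mul0r mulr0 addr0.
  rewrite -{1}(downK m0) par_up !mulrA [_%:R * _]mulrC -mulrDl -mulrDl.
  by rewrite signrN addNr !mul0r.
Qed.

End Representation.
End CliffordWeyl.

(* The Clifford-Weyl algebra C(n, 2k): k counts the pairs (p, q). *)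
Definition clifford_weyl (K : comNzRingType) (n k : nat) : Type :=
  quo_alg (@CW_rel K n k).

Section CliffordWeylAlgebra.
Variables (K : comNzRingType) (n k : nat).

HB.instance Definition _ :=
  GRing.PzRing.copy (clifford_weyl K n k) (quo_alg (@CW_rel K n k)).
HB.instance Definition _ :=
  GRing.Lmodule.copy (clifford_weyl K n k) (quo_alg (@CW_rel K n k)).
HB.instance Definition _ :=
  GRing.PzSemiRing_isNonZero.Build (clifford_weyl K n k) (@CW_one_neq0 K n k).
HB.instance Definition _ := GRing.Lmodule_isLalgebra.Build K
  (clifford_weyl K n k) (@quo_scaleAl K _ (@CW_rel K n k)).
HB.instance Definition _ := GRing.Lalgebra_isAlgebra.Build K
  (clifford_weyl K n k) (@quo_scaleAr K _ (@CW_rel K n k)).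

End CliffordWeylAlgebra.

Notation weyl K k := (clifford_weyl K 0 k).

(* Main.v *)
(* In C(m+2, 2k), let a, b be two of the odd generators and e = i a b.  Then
   e^2 = 1 and e anticommutes with a and b, so that a and b generate a copy of
   the 2 x 2 matrices.  Every other generator x anticommutes with a and b and
   commutes with e; hence e x commutes with a and b, and the elements e x
   satisfy the same relations as the x, which are all quadratic.  This gives
   C(m+2, 2k) = M_2(C(m, 2k)), and an induction from m = 0 or m = 1 finishes. *)

Require Import Defs.
From HB Require Import structures.
From mathcomp Require Import all_boot all_order all_algebra.
From mathcomp Require Import generic_quotient ring_quotient.
From mathcomp Require Import finmap monalg.
From mathcomp Require Import reals complex.

Set Implicit Arguments.
Unset Strict Implicit.
Unset Printing Implicit Defensive.

Import GRing.Theory.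
Local Open Scope ring_scope.
Local Open Scope quotient_scope.

(** * Generators of C(n, 2k): induction principle and universal property *)

Section Generators.
Variables (K : comNzRingType) (n k : nat).
Local Notation C := (clifford_weyl K n k).

Definition cw_gen (g : CW_gen n k) : C := \pi_(quo_alg _) (free_gen K g).

(* With these two coefficients the six families of relations all read
   g h = cw_sign g h *: h g + cw_cst g h. *)
Definition cw_sign (g h : CW_gen n k) : K :=
  match g, h with CWomega _, _ | _, CWomega _ => -1 | _, _ => 1 end.

Definition cw_cst (g h : CW_gen n k) : K :=
  match g, h with
  | CWomega i, CWomega j => (i == j)%:R *+ 2
  | CWp i, CWq j => (i == j)%:R
  | CWq i, CWp j => - (j == i)%:R
  | _, _ => 0
  end.

Lemma pi_cwD x y : \pi_(quo_alg (@CW_rel K n k)) (x + y)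
  = (\pi_(quo_alg _) x : C) + \pi_(quo_alg _) y :> C.
Proof. exact: (raddfD (\pi_(quo_alg (@CW_rel K n k)))). Qed.

(** Words in the generators span the free algebra, the quotient map is onto, and a word is built
    from 1 by left multiplications. *)
Lemma CW_gen_ind (P : C -> Prop) :
  P 1 -> (forall c x y, P x -> P y -> P (c *: x + y)) ->
  (forall g x, P x -> P (cw_gen g * x)) -> forall x, P x.
Proof.
move=> P1 PD PM x.
(* The empty sum needs 0, obtained as the linear combination [-1 *: 1 + 1]. *)
have P0 : P 0 by rewrite -[0](addNr 1) -scaleN1r; apply: PD.
pose mon w : free_alg K (CW_gen n k) := (<< w >> : {malg K[{fmonom CW_gen n k}]}).
have Pmon w : P (\pi_(quo_alg _) (mon w)).
  case: w => w; elim: w => [|g w IHw].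
    suff -> : mon (FMonom [::]) = 1 by [].
    by congr (<< _ >>); apply/val_inj; rewrite /= fm1.
  suff -> : mon (FMonom (g :: w)) = free_gen K g * mon (FMonom w).
    by rewrite quo_piM; apply: PM.
  rewrite free_mulE unlock (malgMEw msuppU_le msuppU_le).
  rewrite !big_seq_fset1 !mcoeffUU mulr1.
  by congr (<< _ >>); apply/val_inj; rewrite /= fmM fmU.
elim/quo_ind: x => f.
have -> : f = \sum_(w <- msupp f) f@_w *: mon w.
  rewrite {1}[f]monalgE; apply: eq_bigr => w _; apply/malgP=> u.
  rewrite mcoeffU [RHS](mcoeffZ f@_w (<< w >> : {malg K[{fmonom CW_gen n k}]})).
  by rewrite mcoeffU mulrnAr mulr1.
elim: (finmap.enum_fset _) => [|w s IH].
  by rewrite big_nil -[X in P X]/(\pi_(quo_alg _) 0) raddf0.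
by rewrite big_cons pi_cwD quo_piZ; apply: PD.
Qed.

Lemma cw_genC g h :
  cw_gen g * cw_gen h = cw_sign g h *: (cw_gen h * cw_gen g) + cw_cst g h *: 1.
Proof.
rewrite /cw_gen -!quo_piM -[1 : C]/(\pi_(quo_alg _) 1) -!quo_piZ -pi_cwD.
have rel_pi f f' : CW_rel (f - f') -> \pi_(quo_alg _) f = \pi_(quo_alg _) f' :> C.
  by move=> r; apply/quoP; apply: IdealGen.
have E (b : bool) : b%:R *: 1 = b%:R :> free_alg K (CW_gen n k).
  by rewrite scaler_nat.
case: g h => [i|i|i] [j|j|j] /=; rewrite ?scale0r ?addr0 ?scaleN1r ?scale1r.
- apply: rel_pi; rewrite opprD opprK addrA -scalerMnl E -(mulr_natl _ 2).
  exact: CW_omega_omega.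
- by apply: rel_pi; rewrite opprK; apply: CW_omega_p.
- by apply: rel_pi; rewrite opprK; apply: CW_omega_q.
- by apply: rel_pi; rewrite opprK addrC; apply: CW_omega_p.
- by apply: rel_pi; apply: CW_p_p.
- by apply: rel_pi; rewrite E opprD addrA; apply: CW_p_q.
- by apply: rel_pi; rewrite opprK addrC; apply: CW_omega_q.
(* The pair q, p is the relation [CW_p_q j i] read from right to left. *)
- apply/esym/rel_pi; rewrite scaleNr E addrAC; exact: CW_p_q.
- by apply: rel_pi; apply: CW_q_q.
Qed.

(** The free algebra acts on [V] through [T] and its defining ideal acts by 0, so any representative
    of [x] may be applied to [v0]. *)
Lemma CW_gen_lift (V : lmodType K) (T : CW_gen n k -> {linear V -> V}) (v0 : V) :
  (forall g h v,
     T g (T h v) = cw_sign g h *: T h (T g v) + cw_cst g h *: v) ->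
  exists2 S : {linear C -> V}, S 1 = v0 & forall g x, S (cw_gen g * x) = T g (S x).
Proof.
move=> HT; pose S (x : C) := free_act T (repr x) v0.
have SE f : S (\pi_(quo_alg _) f) = free_act T f v0.
  apply/eqP; rewrite -subr_eq0 -free_actN -free_actD; apply/eqP.
  apply: ideal_gen_act (quo_repr _ _) => i j v; rewrite HT /=
    ?scaleN1r ?scale1r ?scale0r ?addr0 ?addNr //.
  - by rewrite addrAC addNr add0r -scalerMnl scaler_nat.
  - by rewrite addrAC subrr add0r scaler_nat.
have Slin : linear S.
  move=> c x y; elim/quo_ind: x => x; elim/quo_ind: y => y.
  rewrite -quo_piZ -pi_cwD !SE.
  exact: (linearP (free_act_at T v0)).
pose Sb := GRing.isLinear.Build K C V _ S Slin.
pose SL : {linear C -> V} := HB.pack S Sb.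
exists SL; first by rewrite /= -[1]/(\pi_(quo_alg _) 1) SE free_act1.
move=> g x; elim/quo_ind: x => x /=.
by rewrite -quo_piM !SE free_actM free_act_gen.
Qed.

(* The product is an explicit argument because mx_alg r A is not an algType. *)
Lemma CW_gen_morph (V : lmodType K) (mul : V -> V -> V) (e : V)
    (t : CW_gen n k -> V) :
  associative mul -> left_id e mul -> right_id e mul ->
  (forall u, linear (mul u)) -> (forall v, linear (mul^~ v)) ->
  (forall g h, mul (t g) (t h) = cw_sign g h *: mul (t h) (t g) + cw_cst g h *: e) ->
  exists S : {linear C -> V}, [/\ S 1 = e,
    {morph S : x y / x * y >-> mul x y} & forall g, S (cw_gen g) = t g].
Proof.
move=> mulA mul1 mule linr linl tC.
pose T g : {linear V -> V} :=
  HB.pack (mul (t g)) (GRing.isLinear.Build K V V _ (mul (t g)) (linr (t g))).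
pose mulr v : {linear V -> V} :=
  HB.pack (mul^~ v) (GRing.isLinear.Build K V V _ (mul^~ v) (linl v)).
(* [V] is taken as the left regular module, with the unit [e] as starting vector. *)
have [|S S1 SM] := @CW_gen_lift V T e.
  move=> g h v; rewrite /= !mulA tC -[LHS]/(mulr v _) linearD !linearZ /=.
  by rewrite mul1.
exists S; split=> // [x y|g]; last by rewrite -[cw_gen g in LHS]mulr1 SM S1 /= mule.
elim/CW_gen_ind: x => [|c x1 x2 IH1 IH2|g x IH].
- by rewrite mul1r S1 mul1.
- by rewrite mulrDl -scalerAl !linearP IH1 IH2 linl.
- by rewrite -mulrA !SM /= IH mulA.
Qed.

End Generators.

(** * The generators of C(m+2, 2k): two new odd ones and those of C(m, 2k) *)

Section Extension.
Variables (m k : nat).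

Definition cw_new (j : 'I_2) : CW_gen (2 + m) k := CWomega k (lshift m j).

Definition cw_old (g : CW_gen m k) : CW_gen (2 + m) k :=
  match g with
  | CWomega i => CWomega k (rshift 2 i)
  | CWp i => CWp (2 + m) i
  | CWq i => CWq (2 + m) i
  end.

Definition cw_extend (V : Type) (a b : V) (t : CW_gen m k -> V)
    (g : CW_gen (2 + m) k) : V :=
  match g with
  | CWomega i => match split i with
                 | inl j => if j == ord0 then a else b
                 | inr i => t (CWomega k i)
                 end
  | CWp i => t (CWp m i)
  | CWq i => t (CWq m i)
  end.

Lemma cw_newP (P : CW_gen (2 + m) k -> Prop) :
  P (cw_new ord0) -> P (cw_new ord_max) -> (forall g, P (cw_old g)) ->
  forall g, P g.
Proof.
move=> P0 P1 Pold [i|i|i]; [|exact: (Pold (CWp m i))|exact: (Pold (CWq m i))].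
have [j ->|j ->] := split_ordP i; last exact: (Pold (CWomega k j)).
have [->|] := eqVneq j ord0; first exact: P0.
case: j => [[|[|[]]]] //= lt1 _.
by rewrite (_ : Ordinal _ = ord_max) //; apply/val_inj.
Qed.

Section Extend.
Variables (V : Type) (a b : V) (t : CW_gen m k -> V).

Lemma cw_extend0 : cw_extend a b t (cw_new ord0) = a.
Proof. by rewrite /= (unsplitK (inl _)). Qed.

Lemma cw_extend1 : cw_extend a b t (cw_new ord_max) = b.
Proof. by rewrite /= (unsplitK (inl _)). Qed.

Lemma cw_extend_old g : cw_extend a b t (cw_old g) = t g.
Proof. by case: g => //= i; rewrite (unsplitK (inr _)). Qed.

End Extend.

Variable K : comNzRingType.

Lemma cw_sign_old g h : cw_sign K (cw_old g) (cw_old h) = cw_sign K g h.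
Proof. by case: g h => [?|?|?] []. Qed.

Lemma cw_cst_old g h : cw_cst K (cw_old g) (cw_old h) = cw_cst K g h.
Proof. by case: g h => [?|?|?] [] //= ?; rewrite (inj_eq (@rshift_inj _ _)). Qed.

Lemma cw_sign_newl j h : cw_sign K (cw_new j) h = -1.
Proof. by case: h. Qed.

Lemma cw_sign_newr h j : cw_sign K h (cw_new j) = -1.
Proof. by case: h. Qed.

Lemma cw_cst_new j l : cw_cst K (cw_new j) (cw_new l) = (j == l)%:R *+ 2.
Proof. by rewrite /= (inj_eq (@lshift_inj _ _)). Qed.

Lemma cw_cst_new_old j h : cw_cst K (cw_new j) (cw_old h) = 0.
Proof. by case: h => //= i; rewrite eq_lrshift mul0rn. Qed.

Lemma cw_cst_old_new h j : cw_cst K (cw_old h) (cw_new j) = 0.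
Proof. by case: h => //= i; rewrite eq_rlshift mul0rn. Qed.

End Extension.

(** The relation for equal indices only says that twice the square is 2; [half] cancels the
    factor. *)
Lemma cw_omega_sqr (K : comNzRingType) (n k : nat) (half : K) (i : 'I_n) :
  half + half = 1 -> cw_gen K (CWomega k i) * cw_gen K (CWomega k i) = 1.
Proof.
move=> halfD; have := cw_genC K (CWomega k i) (CWomega k i).
rewrite /= eqxx scaleN1r addrC => /eqP.
rewrite -subr_eq opprK => /eqP ww.
rewrite -[LHS]scale1r -halfD scalerDl -scalerDr ww.
by rewrite scalerA mulr2n mulrDr mulr1 halfD scale1r.
Qed.

(** * Matrix units from two anticommuting square roots of 1 *)

Section Quaternion.
Variables (K : comNzRingType) (A : algType K) (im half : K) (a b : A).
Hypotheses (imM : im * im = -1) (halfD : half + half = 1).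
Hypotheses (aa : a * a = 1) (bb : b * b = 1) (abC : a * b = - (b * a)).

(* qE00, .., qE11 are matrix units: qe is diag(1, -1), a is the swap and
   b = i qe a. *)
Definition qe : A := im *: (a * b).

Lemma qe_anticomm : a * qe = - (qe * a).
Proof.
by rewrite /qe -scalerAr -scalerAl -scalerN -mulrA -[b * a]opprK -abC mulrN opprK.
Qed.

Lemma qe_anticommr : b * qe = - (qe * b).
Proof.
by rewrite /qe -scalerAr -scalerAl -scalerN mulrA -[b * a]opprK -abC mulNr.
Qed.

Lemma qe_sqr : qe * qe = 1.
Proof.
rewrite /qe -scalerAl -scalerAr scalerA imM mulrA -[a * b * a]mulrA.
by rewrite -[b * a]opprK -abC mulrN mulrA aa mul1r mulNr bb scalerN scaleN1r opprK.
Qed.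

Definition qE00 : A := half *: (1 + qe).
Definition qE11 : A := half *: (1 - qe).
Definition qE01 : A := qE00 * a.
Definition qE10 : A := qE11 * a.

Lemma qE_one : qE00 + qE11 = 1.
Proof. by rewrite -scalerDr addrACA subrr addr0 scalerDr -scalerDl halfD scale1r. Qed.

(** As [qe] squares to 1, it fixes [1 + qe] and negates [1 - qe]; so left multiplication by [qe] is
    1 on the units of row 0 and -1 on those of row 1. *)
Lemma mul_qeE00 : qe * qE00 = qE00.
Proof. by rewrite /qE00 -scalerAr mulrDr mulr1 qe_sqr addrC. Qed.

Lemma mul_qeE11 : qe * qE11 = - qE11.
Proof. by rewrite /qE11 -scalerAr mulrBr mulr1 qe_sqr -scalerN opprB. Qed.

Lemma mul_qeE01 : qe * qE01 = qE01.
Proof. by rewrite mulrA mul_qeE00. Qed.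

Lemma mul_qeE10 : qe * qE10 = - qE10.
Proof. by rewrite mulrA mul_qeE11 mulNr. Qed.

(** Moving [a] across [qe] turns [1 + qe] into [1 - qe]: left multiplication by [a] swaps the two
    rows. *)
Lemma mul_aE00 : a * qE00 = qE10.
Proof.
rewrite /qE10 /qE11 /qE00 -scalerAr -scalerAl mulrDr mulr1.
by rewrite qe_anticomm mulrBl mul1r.
Qed.

Lemma mul_aE11 : a * qE11 = qE01.
Proof.
rewrite /qE01 /qE11 /qE00 -scalerAr -scalerAl mulrBr mulr1.
by rewrite qe_anticomm opprK mulrDl mul1r.
Qed.

Lemma mul_aE01 : a * qE01 = qE11.
Proof. by rewrite mulrA mul_aE00 /qE10 -mulrA aa mulr1. Qed.

Lemma mul_aE10 : a * qE10 = qE00.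
Proof. by rewrite mulrA mul_aE11 /qE01 -mulrA aa mulr1. Qed.

(** This reduces the products of [b] with the units to those of [a] and [qe]. *)
Lemma qbE : b = im *: (qe * a).
Proof.
rewrite /qe -scalerAl -mulrA -[b * a]opprK -abC mulrN mulrA aa mul1r.
by rewrite scalerN scalerN scalerA imM scaleN1r opprK.
Qed.

Lemma mul_bE00 : b * qE00 = - im *: qE10.
Proof. by rewrite qbE -scalerAl -mulrA mul_aE00 mul_qeE10 scalerN scaleNr. Qed.

Lemma mul_bE01 : b * qE01 = - im *: qE11.
Proof. by rewrite qbE -scalerAl -mulrA mul_aE01 mul_qeE11 scalerN scaleNr. Qed.

Lemma mul_bE10 : b * qE10 = im *: qE00.
Proof. by rewrite qbE -scalerAl -mulrA mul_aE10 mul_qeE00. Qed.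

Lemma mul_bE11 : b * qE11 = im *: qE01.
Proof. by rewrite qbE -scalerAl -mulrA mul_aE11 mul_qeE01. Qed.

(** The 2 x 2 matrix with rows (u, v) and (w, z), expanded in the matrix units. *)
Definition qsum (u v w z : A) : A := u * qE00 + v * qE01 + w * qE10 + z * qE11.

Lemma qsumP c u v w z u' v' w' z' :
  qsum (c *: u + u') (c *: v + v') (c *: w + w') (c *: z + z')
  = c *: qsum u v w z + qsum u' v' w' z'.
Proof.
rewrite /qsum !mulrDl -!scalerAl !scalerDr.
by do 2!(rewrite [RHS]addrACA; congr (_ + _)); rewrite [RHS]addrACA.
Qed.

Lemma qsum_one : qsum 1 0 0 1 = 1.
Proof. by rewrite /qsum !mul0r !mul1r !addr0 qE_one. Qed.

Lemma mul_qsum x u v w z : x * qsum u v w z = qsum (x * u) (x * v) (x * w) (x * z).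
Proof. by rewrite /qsum !mulrDr !mulrA. Qed.

Section Commuting.
Variables u v w z : A.
Hypothesis (au : a * u = u * a) (av : a * v = v * a).
Hypothesis (aw : a * w = w * a) (az : a * z = z * a).

(** The coefficients let [a] pass through to the units, where it swaps the rows; [b] and [qe] are
    treated alike below. *)
Lemma mul_a_qsum : a * qsum u v w z = qsum w z u v.
Proof.
rewrite mul_qsum au av aw az /qsum -!mulrA.
by rewrite mul_aE00 mul_aE01 mul_aE10 mul_aE11 -addrA addrC addrA.
Qed.

Hypothesis (bu : b * u = u * b) (bv : b * v = v * b).
Hypothesis (bw : b * w = w * b) (bz : b * z = z * b).

Lemma mul_b_qsum :
  b * qsum u v w z = qsum (im *: w) (im *: z) (- (im *: u)) (- (im *: v)).
Proof.
rewrite mul_qsum bu bv bw bz /qsum -!mulrA.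
rewrite mul_bE00 mul_bE01 mul_bE10 mul_bE11.
by rewrite !mulNr -!scalerAl -!scalerAr !scaleNr -addrA addrC addrA.
Qed.

Lemma mul_qe_qsum : qe * qsum u v w z = qsum u v (- w) (- z).
Proof.
(* What commutes with [a] and [b] commutes with [qe], a multiple of their product. *)
have eC y : a * y = y * a -> b * y = y * b -> qe * y = y * qe.
  by move=> ay yb; rewrite /qe -scalerAl -scalerAr -mulrA yb mulrA ay mulrA.
rewrite mul_qsum !eC // /qsum -!mulrA.
by rewrite mul_qeE00 mul_qeE01 mul_qeE10 mul_qeE11 !mulrN !mulNr.
Qed.

End Commuting.

End Quaternion.

(** * Block matrices over an algebra *)

Section MatrixBlocks.
Variables (K : comNzRingType) (B : algType K) (r : nat).
Local Notation M := (mx_alg r B).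

(** Typed in [mx_alg], so that product and scaling are those of the K-algebra of matrices. *)
Definition mxb (u v w z : M) : mx_alg (r + r) B := block_mx u v w z.

Lemma mxbM u v w z u' v' w' z' : mxb u v w z * mxb u' v' w' z'
  = mxb (u * u' + v * w') (u * v' + v * z') (w * u' + z * w') (w * v' + z * z').
Proof. exact: mulmx_block. Qed.

Lemma mxbD u v w z u' v' w' z' : mxb u v w z + mxb u' v' w' z'
  = mxb (u + u') (v + v') (w + w') (z + z').
Proof. exact: add_block_mx. Qed.

Lemma mxbN u v w z : - mxb u v w z = mxb (- u) (- v) (- w) (- z).
Proof. exact: opp_block_mx. Qed.

Lemma mxbZ c u v w z : c *: mxb u v w z = mxb (c *: u) (c *: v) (c *: w) (c *: z).
Proof.
apply/matrixP=> i j; rewrite mxE.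
by case: (split_ordP i) (split_ordP j) => [i' ->|i' ->] [j' ->|j' ->];
  rewrite /mxb ?block_mxEul ?block_mxEur ?block_mxEdl ?block_mxEdr mxE.
Qed.

Lemma mxb1 : 1 = mxb 1 0 0 1.
Proof. exact: scalar_mx_block. Qed.

End MatrixBlocks.

Lemma mx_alg_mul_linear (K : comNzRingType) (B : algType K) r (u : mx_alg r B) :
  linear (fun v : mx_alg r B => u * v).
Proof. by move=> c v w; rewrite mulrDr mx_alg_scaleAr. Qed.

Lemma mx_alg_mulr_linear (K : comNzRingType) (B : algType K) r (v : mx_alg r B) :
  linear (fun u : mx_alg r B => u * v).
Proof. by move=> c u w; rewrite mulrDl mx_alg_scaleAl. Qed.

Definition alg_iso (K : comNzRingType) (A B : algType K) (r : nat) :=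
  exists f : {lrmorphism A -> mx_alg r B}, bijective f.

(** * The inductive step, from C(m, 2k) to C(m+2, 2k) *)

Section Step.
Variables (K : comNzRingType) (im half : K) (m k r : nat) (B : algType K).
Hypotheses (imM : im * im = -1) (halfD : half + half = 1).
Variable phi : {lrmorphism clifford_weyl K m k -> mx_alg r B}.
Variable psi : mx_alg r B -> clifford_weyl K m k.
Hypotheses (phiK : cancel phi psi) (psiK : cancel psi phi).

Local Notation A := (clifford_weyl K (2 + m) k).
Local Notation D := (mx_alg (r + r) B).
Local Notation a := (cw_gen K (cw_new m k ord0) : A).
Local Notation b := (cw_gen K (cw_new m k ord_max) : A).
Local Notation x_ g := (cw_gen K (cw_old g) : A).

Let aa : a * a = 1. Proof. exact: cw_omega_sqr halfD. Qed.
Let bb : b * b = 1. Proof. exact: cw_omega_sqr halfD. Qed.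
Let abC : a * b = - (b * a).
Proof. by rewrite cw_genC cw_sign_newl cw_cst_new mul0rn scale0r addr0 scaleN1r. Qed.
Let axC g : a * x_ g = - (x_ g * a).
Proof. by rewrite cw_genC cw_sign_newl cw_cst_new_old scale0r addr0 scaleN1r. Qed.
Let bxC g : b * x_ g = - (x_ g * b).
Proof. by rewrite cw_genC cw_sign_newl cw_cst_new_old scale0r addr0 scaleN1r. Qed.

Local Notation e := (qe im a b).

Let exC g : e * x_ g = x_ g * e.
Proof.
by rewrite -scalerAl -scalerAr -mulrA bxC mulrN mulrA axC mulNr opprK mulrA.
Qed.

Let ee : e * e = 1. Proof. exact: qe_sqr. Qed.

(* All defining relations are even, and e commutes with the old generators and
   has square 1, so x |-> e x preserves them. *)
Lemma even_embedding : exists h : {linear clifford_weyl K m k -> A},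
  [/\ h 1 = 1, {morph h : x y / x * y} & forall g, h (cw_gen K g) = e * x_ g].
Proof.
apply: CW_gen_morph; [exact: mulrA|exact: mul1r|exact: mulr1| | |].
- by move=> u c v w; rewrite mulrDr scalerAr.
- by move=> u c v w; rewrite mulrDl scalerAl.
move=> g h; have M i j : e * x_ i * (e * x_ j) = x_ i * x_ j.
  by rewrite exC mulrA -[x_ i * e * e]mulrA ee mulr1.
by rewrite !M cw_genC cw_sign_old cw_cst_old.
Qed.

Local Notation one r := (1 : mx_alg r B).

(** The new generators go to Pauli matrices up to sign, chosen so that [e] goes to diag(1, -1). An
    old x is [e] times e x, and e x is to go to diag(phi x, phi x); hence the sign in the last
    block. *)
Definition step_gen : CW_gen (2 + m) k -> D :=
  cw_extend (mxb 0 1 1 0)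
    (mxb 0 (im *: one r) (- (im *: one r)) 0)
    (fun g => mxb (phi (cw_gen K g)) 0 0 (- phi (cw_gen K g))).

Let phiZ c x : phi (c *: x) = c *: phi x.
Proof. exact: linearZ. Qed.
Let phiD x y : phi (x + y) = phi x + phi y.
Proof. exact: raddfD. Qed.
Let phiM x y : phi (x * y) = phi x * phi y.
Proof. exact: rmorphM. Qed.
Let phi1 : phi 1 = 1.
Proof. exact: rmorph1. Qed.

Let phiC g h : phi (cw_gen K g) * phi (cw_gen K h)
  = cw_sign K g h *: (phi (cw_gen K h) * phi (cw_gen K g)) + cw_cst K g h *: one r.
Proof.
rewrite -(phiM (cw_gen K g)) -(phiM (cw_gen K h)) (cw_genC K g h).
rewrite phiD; congr (_ + _); first exact: phiZ.
by rewrite -phi1 -phiZ.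
Qed.

Let mxbE := (mxbM, mxbZ, mxbD, mxbN, mxb1 B r, mul0r, mulr0, addr0, add0r,
  oppr0, mulNr, mulrN, mul1r, mulr1, scaler0, scale0r, @opprK, scaleN1r).

(** Off-diagonal images of new generators anticommute with the diag(y, -y) of old ones. For two old
    generators the signs cancel and [phiC] applies in each block. *)
Lemma step_genC g h : step_gen g * step_gen h
  = cw_sign K g h *: (step_gen h * step_gen g) + cw_cst K g h *: one (r + r).
Proof.
have imC u : (im *: one r) * u = u * (im *: one r).
  by rewrite -mx_alg_scaleAl -mx_alg_scaleAr mul1r mulr1.
have imm : (im *: one r) * (im *: one r) = -1.
  by rewrite -mx_alg_scaleAl mul1r scalerA imM scaleN1r.
have one2 : -1 + (1 *+ 2) *: one r = 1 by rewrite -scalerMnl scale1r mulr2n addKr.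
move: g h; elim/cw_newP => [||g]; elim/cw_newP => [||h];
  rewrite /step_gen !(cw_extend0, cw_extend1, cw_extend_old)
    ?(cw_sign_newl, cw_sign_newr, cw_cst_new, cw_cst_new_old, cw_cst_old_new,
      cw_sign_old, cw_cst_old) !mxbE //.
- by rewrite eqxx one2.
- by rewrite mulr0n mul0rn scale0r !addr0.
- by rewrite mulr0n mul0rn scale0r !addr0.
- by rewrite eqxx imm one2 opprK.
- by rewrite imC.
- by rewrite imC.
- by rewrite phiC.
Qed.

(** The algebra [B] stays fixed while the size doubles: 2 x 2 matrices over M_r(B) are taken
    directly as block matrices over [B]. Bijectivity comes from an explicit inverse [G]. *)
Lemma clifford_weyl_step : exists f : {lrmorphism A -> mx_alg (r + r) B}, bijective f.
Proof.
have [h [h1 hM hg]] := even_embedding.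
have [||||||f [f1 fM fg]] := @CW_gen_morph K (2 + m) k D *%R 1 step_gen.
- exact: mulrA.
- exact: mul1r.
- exact: mulr1.
- exact: mx_alg_mul_linear.
- exact: mx_alg_mulr_linear.
- exact: step_genC.
have hP : linear h := linearP h.
have fP : linear f := linearP f.
have fa : f a = mxb 0 1 1 0 by rewrite fg /step_gen cw_extend0.
have fb : f b = mxb 0 (im *: one r) (- (im *: one r)) 0.
  by rewrite fg /step_gen cw_extend1.
have fx g : f (x_ g) = mxb (phi (cw_gen K g)) 0 0 (- phi (cw_gen K g)).
  by rewrite fg /step_gen cw_extend_old.
have fe : f e = mxb 1 0 0 (-1).
  by rewrite linearZ /= fM fa fb !mxbE scalerN scalerA imM scaleN1r opprK.
(* The sign in the image of [e] cancels the one in the image of x. *)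
have fh y : f (h y) = mxb (phi y) 0 0 (phi y).
  elim/CW_gen_ind: y => [|c x y IHx IHy|g y IH].
  - by rewrite h1 f1 !mxbE phi1.
  - by rewrite hP fP phiD phiZ IHx IHy mxbZ mxbD !scaler0 !addr0.
  - by rewrite hM hg !fM fe fx IH phiM !mxbE.
pose E00 := qE00 im half a b; pose E01 := qE01 im half a b.
pose E10 := qE10 im half a b; pose E11 := qE11 im half a b.
have fE00 : f E00 = mxb 1 0 0 0.
  rewrite linearZ linearD /= f1 fe !mxbE addrN !mxbE scalerDr -scalerDl halfD.
  by rewrite scale1r.
have fE11 : f E11 = mxb 0 0 0 1.
  rewrite linearZ linearB /= f1 fe !mxbE addrN !mxbE scalerDr -scalerDl halfD.
  by rewrite scale1r.
have fE01 : f E01 = mxb 0 1 0 0 by rewrite fM fE00 fa !mxbE.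
have fE10 : f E10 = mxb 0 0 1 0 by rewrite fM fE11 fa !mxbE.
(* The blocks, carried to [A] by [psi] and then [h], become the coefficients of the matrix units. *)
pose G (M : D) : A := qsum im half a b (h (psi (ulsubmx M))) (h (psi (ursubmx M)))
  (h (psi (dlsubmx M))) (h (psi (drsubmx M))).
have GE u v w z : G (mxb u v w z)
    = qsum im half a b (h (psi u)) (h (psi v)) (h (psi w)) (h (psi z)).
  by rewrite /G /mxb block_mxKul block_mxKur block_mxKdl block_mxKdr.
have mxb_surj (M : D) : exists u v w z, M = mxb u v w z.
  exists (ulsubmx M), (ursubmx M), (dlsubmx M), (drsubmx M).
  by rewrite /mxb submxK.
(* [psi] is a bare function; its algebraic properties are transferred from [phi] by cancellation. *)
have psiP c u v : psi (c *: u + v) = c *: psi u + psi v.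
  by apply: (canLR phiK); rewrite phiD phiZ !psiK.
have G_lin : linear G.
  move=> c M N.
  have [u [v [w [z ->]]]] := mxb_surj M; have [u' [v' [w' [z' ->]]]] := mxb_surj N.
  by rewrite mxbZ mxbD !GE !(psiP c) !(hP c) qsumP.
have psi_phiM x u : psi (phi x * u) = x * psi u.
  by apply: (canLR phiK); rewrite phiM psiK.
have hpsiN u : h (psi (- u)) = - h (psi u).
  rewrite -linearN; congr (h _).
  by apply: (canLR phiK); rewrite raddfN /= psiK.
have hpsiZ c u : h (psi ((c *: one r) * u)) = c *: h (psi u).
  rewrite -linearZ; congr (h _).
  by apply: (canLR phiK); rewrite phiZ psiK -mx_alg_scaleAl mul1r.
(* Both [e] and x anticommute with [a], so e x commutes with it. *)
have haC y : a * h y = h y * a.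
  elim/CW_gen_ind: y => [|c x y IHx IHy|g y IH].
  - by rewrite h1 mulr1 mul1r.
  - by rewrite hP mulrDr mulrDl -scalerAr -scalerAl IHx IHy.
  - rewrite hM hg mulrA -[_ * _ * a]mulrA -IH !mulrA; congr (_ * _).
    by rewrite (qe_anticomm im abC) !mulNr -!mulrA axC mulrN opprK.
have hbC y : b * h y = h y * b.
  elim/CW_gen_ind: y => [|c x y IHx IHy|g y IH].
  - by rewrite h1 mulr1 mul1r.
  - by rewrite hP mulrDr mulrDl -scalerAr -scalerAl IHx IHy.
  - rewrite hM hg mulrA -[_ * _ * b]mulrA -IH !mulrA; congr (_ * _).
    by rewrite (qe_anticommr im abC) !mulNr -!mulrA bxC mulrN opprK.
(* G intertwines the two left actions of A, and G 1 = 1, so G (f x) = x. *)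
have Gf_mul x M : G (f x * M) = x * G M.
  elim/CW_gen_ind: x M => [|c x y IHx IHy|g x IH] M.
  - by rewrite f1 !mul1r.
  - by rewrite fP mulrDl -mx_alg_scaleAl G_lin IHx IHy mulrDl scalerAl.
  (* After the induction hypothesis, one generator remains to be moved through [G], on an arbitrary
     block matrix [N]. *)
  - rewrite fM -!mulrA -IH; move: (f x * M) => {x M IH} N.
    have [u [v [w [z ->]]]] := mxb_surj N.
    elim/cw_newP: g => [||g].
    + rewrite fa mxbM !(mul0r, mul1r, addr0, add0r) !GE.
      by rewrite mul_a_qsum.
    + rewrite fb mxbM !(mul0r, addr0, add0r, mulNr) !GE !hpsiN !hpsiZ.
      by rewrite mul_b_qsum.
    + rewrite fx mxbM !(mul0r, addr0, add0r, mulNr) !GE !hpsiN !psi_phiM !hM.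
      (* Since [e] squares to 1, multiplying by x amounts to multiplying the coefficients by e x,
         then the rows by 1 and -1. *)
      have -> : x_ g = e * h (cw_gen K g) by rewrite hg mulrA ee mul1r.
      by rewrite -mulrA mul_qsum mul_qe_qsum // -hM.
have GfK : cancel f G.
  move=> x; rewrite -[f x]mulr1 Gf_mul mxb1 GE.
  have -> : psi 1 = 1 by apply: (canLR phiK); rewrite phi1.
  have -> : psi 0 = 0 by apply: (canLR phiK); rewrite raddf0.
  by rewrite h1 linear0 qsum_one // mulr1.
have fGK : cancel G f.
  move=> M; have [u [v [w [z ->]]]] := mxb_surj M.
  have fhE y E : f (h y * E) = mxb (phi y) 0 0 (phi y) * f E by rewrite fM fh.
  have fD x y : f (x + y) = f x + f y by exact: raddfD.
  (* Each scalar block matrix is cut down by its matrix unit to a single block of [M]. *)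
  rewrite GE 3!fD; transitivity (
    mxb u 0 0 u * mxb 1 0 0 0 + mxb v 0 0 v * mxb 0 1 0 0
    + mxb w 0 0 w * mxb 0 0 1 0 + mxb z 0 0 z * mxb 0 0 0 1).
    by congr (_ + _ + _ + _); rewrite fhE psiK; congr (_ * _).
  by rewrite !mxbM !mxbD !(mul0r, mulr0, mulr1, addr0, add0r).
pose fmor := GRing.isMonoidMorphism.Build A D f (conj f1 fM).
pose F : {lrmorphism A -> D} := HB.pack (f : A -> D) (GRing.Linear.class f) fmor.
exists F; exact: (Bijective GfK fGK).
Qed.

End Step.

(** * The induction on n *)

Lemma alg_iso_scalar (K : comNzRingType) (A : algType K) : alg_iso A A 1.
Proof.
pose f (x : A) : mx_alg 1 A := x%:M.
have f_lin : linear f.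
  move=> c x y; apply/matrixP=> i j.
  by rewrite !ord1 [RHS]mxE [X in _ = X + _]mxE !mxE eqxx !mulr1n.
have f_mor : monoid_morphism f by split=> // x y; apply: scalar_mxM.
pose fmor := GRing.isMonoidMorphism.Build A (mx_alg 1 A) f f_mor.
pose F : {lrmorphism A -> mx_alg 1 A} :=
  HB.pack f (GRing.isLinear.Build K A (mx_alg 1 A) _ f f_lin) fmor.
exists F; exists (fun M : mx_alg 1 A => M 0 0) => [x|M]; first by rewrite mxE eqxx.
by apply/matrixP=> i j; rewrite !ord1 mxE eqxx.
Qed.

(** With [m] arbitrary, one induction serves both parities; its base case is 1 x 1 matrices. *)
Lemma alg_iso_clifford_weyl (K : comNzRingType) (im half : K) (n m k : nat) :
  im * im = -1 -> half + half = 1 ->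
  alg_iso (clifford_weyl K (2 * n + m) k) (clifford_weyl K m k) (2 ^ n).
Proof.
move=> imM halfD; elim: n => [|n [phi [psi phiK psiK]]]; first exact: alg_iso_scalar.
(* Reshapes the index to [2 + (2 * n + m)] and the size to [2 ^ n + 2 ^ n], as in the inductive
   step. *)
rewrite mulnS -addnA expnS [(2 * 2 ^ n)%N]mul2n -addnn.
exact (clifford_weyl_step imM halfD phiK psiK).
Qed.

Local Open Scope complex_scope.

Theorem theorem1 (R : realType) (n k : nat) :
  (exists f : {lrmorphism clifford_weyl R[i] (2 * n) k
                 -> mx_alg (2 ^ n) (weyl R[i] k)},
     bijective f) /\
  (exists f : {lrmorphism clifford_weyl R[i] (2 * n + 1) k
                 -> mx_alg (2 ^ n) (clifford_weyl R[i] 1 k)},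
     bijective f).
Proof.
have imM : 'i * 'i = -1 :> R[i] by rewrite -expr2 sqr_i.
have halfD : 2^-1 + 2^-1 = 1 :> R[i].
  by rewrite -mulr2n -[LHS]mulr_natr mulVf // Num.Theory.pnatr_eq0.
split; last exact: alg_iso_clifford_weyl imM halfD.
(* The even case is [m = 0]. *)
rewrite -[(2 * n)%N]addn0; exact: alg_iso_clifford_weyl imM halfD.
Qed.
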